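(* Let $S\subseteq\mathbb{N}^2$ be a gap absorbing monoid. Then $\mathbf{s}\in\operatorname{Betti}(S)$ if and only if $\mathbf{s}\in 2\mathcal{A}(S)$ and $|\mathsf{Z}(\mathbf{s})|\ge 2$.
   Context: $\mathbb{N}$ is the set of non-negative integers and $\mathbb{N}^2$ is the additive monoid with componentwise addition; $\mathbf{0}=(0,0)$. For $X,Y\subseteq\mathbb{N}^2$, $X+Y=\{x+y:x\in X,\ y\in Y\}$ and $2X=X+X$. For a submonoid $S$ of $\mathbb{N}^2$: $S^*=S\setminus\{\mathbf{0}\}$; $\mathcal{H}(S)=\mathbb{N}^2\setminus S$ is the set of gaps; $\mathcal{A}(S)=S^*\setminus(S^*+S^* )$ is the set of atoms. $S$ is gap absorbing if $2\mathcal{H}(S)\subseteq\mathcal{H}(S)\cup\mathcal{A}(S)\cup 2\mathcal{A}(S)$ and $\mathcal{H}(S)+\mathcal{A}(S)\subseteq\mathcal{A}(S)\cup 2\mathcal{A}(S)$. For $\mathbf{s}\in S$, $\mathsf{Z}(\mathbf{s})$ is the set of factorizations of $\mathbf{s}$ into atoms, i.e. the set of finitely supported families $(\lambda_{\mathbf{a}})_{\mathbf{a}\in\mathcal{A}(S)}$ of non-negative integers with $\sum_{\mathbf{a}}\lambda_{\mathbf{a}}\mathbf{a}=\mathbf{s}$. Write $\mathbf{a}\le_S\mathbf{b}$ if $\mathbf{b}-\mathbf{a}\in S$. For $\mathbf{s}\in S$, $\mathbf{G}_{\mathbf{s}}$ is the graph whose vertices are the atoms $\mathbf{a}$ of $S$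 with $\mathbf{a}\le_S\mathbf{s}$, two distinct vertices $\mathbf{a},\mathbf{b}$ being joined by an edge if $\mathbf{a}+\mathbf{b}\le_S\mathbf{s}$. The element $\mathbf{s}$ is a Betti element of $S$ if $\mathbf{G}_{\mathbf{s}}$ is not connected, i.e. it has at least two connected components (the empty graph $\mathbf{G}_{\mathbf{0}}$ is not counted as disconnected); $\operatorname{Betti}(S)$ is the set of Betti elements of $S$. *)

(* Defs.v *)
From mathcomp Require Import all_boot all_order all_algebra finmap.
From mathcomp Require Import all_classical.
From Stdlib Require Import Relations.
Set Implicit Arguments.
Unset Strict Implicit.
Unset Printing Implicit Defensive.
Import GRing.Theory.
Local Open Scope classical_set_scope.
Local Open Scope ring_scope.

Notation N2 := (nat * nat)%type.

Definition submonoid (S : set N2) : Prop := Algebra.nmod_closed (mem S).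

Definition sumset (X Y : set N2) : set N2 := [set x + y | x in X & y in Y].

Definition star (S : set N2) : set N2 := S `\ 0.

Definition gaps (S : set N2) : set N2 := ~` S.

Definition atoms (S : set N2) : set N2 :=
  star S `\` sumset (star S) (star S).

Definition gap_absorbing (S : set N2) : Prop :=
  sumset (gaps S) (gaps S)
    `<=` gaps S `|` atoms S `|` sumset (atoms S) (atoms S) /\
  sumset (gaps S) (atoms S) `<=` atoms S `|` sumset (atoms S) (atoms S).

Definition factorizations (S : set N2) (s : N2) :
    set {fsfun atoms S -> nat with 0%N} :=
  [set l : {fsfun atoms S -> nat with 0%N} |
    \sum_(a <- finsupp l) val a *+ l a = s].
Arguments factorizations : clear implicits.

                                                                              
                                                                   
Definition le_monoid (S : set N2) (a b : N2) : Prop :=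
  exists2 c, S c & a + c = b.

Definition betti_vertices (S : set N2) (s : N2) : set N2 :=
  [set a | atoms S a /\ le_monoid S a s].

Definition betti_edge (S : set N2) (s : N2) (a b : betti_vertices S s) : Prop :=
  a <> b /\ le_monoid S (val a + val b) s.

                                                 
Definition graph_connected (V : Type) (E : V -> V -> Prop) : Prop :=
  forall a b : V, clos_refl_trans V E a b.

Definition Betti (S : set N2) : set N2 :=
  [set s | S s /\ ~ graph_connected (@betti_edge S s)].

(* Main.v *)
(** In a gap absorbing monoid [H + A] lies in [S], so [S^*] is an ideal of [N^2].
    Suppose [s] is in [2 S^*] but not in [2A]. If [u + v = s], the gap absorbing
    inclusions, applied to whichever of [u], [v] are gaps, force [u] or [v] to be
    in [2 S^*]. In particular [s - a] is in [2 S^*] for every atom [a] below [s],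
    which leaves enough room to connect all atoms below [s] in the graph [G_s].
    Hence Betti elements lie in [2A]; and factorizations through atoms of different
    components differ. Conversely the component of [p] in [G_(p + q)] is [{p, q}],
    and a factorization of [p + q] that uses [p] or [q] is [p + q] itself. *)
Require Import Defs.
From mathcomp Require Import all_boot all_order all_algebra finmap.
From mathcomp Require Import all_classical.
From mathcomp Require Import zify.
From Stdlib Require Import Relations.
Local Open Scope classical_set_scope.
Local Open Scope card_scope.

Section GapAbsorbing.
Import GRing.Theory.
Local Open Scope ring_scope.

(** A lower bound of two is an injection of [{0, 1}], that is, a pair of distinct members. *)
Lemma card_ge2P {T : Type} (A : set T) :
  `I_2 #<= A <-> exists x y, [/\ A x, A y & x <> y].
Proof.
split=> [/card_leP[f]|[x [y [xA yA xy]]]].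
  have i0 : `I_2 0%N by [].
  have i1 : `I_2 1%N by [].
  pose x := f (SigSub (mem_set i0)); pose y := f (SigSub (mem_set i1)).
  exists (val x), (val y); split; [exact: set_valP|exact: set_valP|].
  by move=> /val_inj/(in2TT (@inj _ _ _ f))/(congr1 val).
suff [f] : $|{injfun `I_2 >-> A}| by exact: inj_card_le.
apply/injfunPex; exists (fun i => if i == 0%N then x else y).
  by move=> i _ /=; case: ifP.
by move=> [|[|i]] [|[|j]] //=; rewrite !inE //= => _ _ E; case: xy.
Qed.

Lemma addN2_eq (x y z : N2) :
  x + y = z <-> (x.1 + y.1)%N = z.1 /\ (x.2 + y.2)%N = z.2.
Proof.
case: x y z => [x1 x2] [y1 y2] [z1 z2]; split=> [[<- <-]|[/= <- <-]] //.
Qed.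

Lemma addN2_cancel (x y z : N2) : x + y = x + z -> y = z.
Proof.
by case: x y z => [? ?] [? ?] [? ?] [/addnI -> /addnI ->].
Qed.

(** * Submonoids of [N^2] and their atoms *)

Context {S : set N2} (hS : submonoid S).

Lemma submonoid0 : S 0.
Proof. by case: hS => + _; rewrite inE. Qed.

Lemma submonoidD x y : S x -> S y -> S (x + y).
Proof.
by case: hS => _ SD Sx Sy; have := SD x y; rewrite !inE; apply.
Qed.

Lemma starP x : star S x <-> S x /\ (0 < x.1 + x.2)%N.
Proof.
split=> -[Sx x0]; split=> //; last by move=> xE; rewrite xE in x0.
by rewrite lt0n; apply/eqP => x12; apply: x0; case: x x12 {Sx} => -[|?] [|?].
Qed.

Lemma starD x y : star S x -> S y -> star S (x + y).
Proof.
move=> /starP[Sx x0] Sy; apply/starP; split; first exact: submonoidD.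
by rewrite /=; lia.
Qed.

Lemma atom_or_sum x : star S x -> atoms S x \/ sumset (star S) (star S) x.
Proof. by move=> xS; case: (pselect (sumset (star S) (star S) x)); [right|left]. Qed.

Lemma atom_mem x : atoms S x -> S x.
Proof. by case=> -[]. Qed.

Lemma atoms2_mem x : sumset (atoms S) (atoms S) x -> S x.
Proof. by move=> [a aA [b bA <-]]; apply: submonoidD; exact: atom_mem. Qed.

Lemma star_atomD x : star S x -> exists2 a, atoms S a & exists2 c, S c & a + c = x.
Proof.
have [n] := ubnP (x.1 + x.2)%N; elim: n x => // n IHn x ltn xS.
have [xA|[y yS [z zS yzE]]] := atom_or_sum x xS.
  by exists x => //; exists 0; [exact: submonoid0|rewrite addr0].
have [|a aA [c cS acE]] := IHn y _ yS.
  have /starP[_ z0] := zS; move/addN2_eq: yzE => [? ?]; lia.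
exists a => //; exists (c + z); last by rewrite addrA acE.
by apply: submonoidD => //; case: zS.
Qed.

(** * Upward closure of [S^*] and [2 S^*] in the componentwise order *)

Context (hgap : gap_absorbing S).

(** For a gap [h], split an atom [a] off [x]: the inclusion for [H + A] puts [h + a] in [S], and the
    rest of [x] is then added inside [S]. *)
Lemma gap_starD h x : star S x -> star S (h + x).
Proof.
move=> xS; have [hS'|hG] := pselect (S h).
  by rewrite addrC; apply: starD.
have [a aA [c cS <-]] := star_atomD x xS.
have haS : S (h + a).
  have [|/atom_mem//|/atoms2_mem//] := hgap.2 (h + a).
  by exists h => //; exists a.
apply/starP; split; first by rewrite addrA; apply: submonoidD.
by case: aA => /starP[_ /=]; lia.
Qed.

(* [S^*] is an ideal of [N^2], not merely of [S]. *)
Lemma star_up x y : (x.1 <= y.1)%N -> (x.2 <= y.2)%N -> star S x -> star S y.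
Proof.
move=> le1 le2 /(gap_starD (y.1 - x.1, y.2 - x.2)%N).
by congr (star S _); apply/addN2_eq; split=> /=; lia.
Qed.

Lemma star2_up x y : (x.1 <= y.1)%N -> (x.2 <= y.2)%N ->
  sumset (star S) (star S) x -> sumset (star S) (star S) y.
Proof.
move=> le1 le2 [u uS [v vS /addN2_eq[E1 E2]]].
exists u => //; exists (y.1 - u.1, y.2 - u.2)%N; last first.
  by apply/addN2_eq; split=> /=; lia.
by apply: star_up vS => /=; lia.
Qed.

(** A decomposition of [x] in [2 S^*] would pass up to the atom [y]. *)
Lemma atom_down x y : (x.1 <= y.1)%N -> (x.2 <= y.2)%N ->
  atoms S y -> star S x -> atoms S x.
Proof. by move=> le1 le2 [_ yN2] xS; split=> // /(star2_up _ _ le1 le2). Qed.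

(** * Paths between the atoms below [s] *)

Section Linked.
Context (s : N2).

(** Paths of [G_s] on bare elements of [N^2], so that no proof of being a vertex has to be carried
    along. *)
Definition linked : N2 -> N2 -> Prop :=
  clos_refl_trans N2 (fun x y =>
    [/\ atoms S x, atoms S y & exists2 z, S z & x + y + z = s]).

Lemma linked_sym x y : linked x y -> linked y x.
Proof.
elim=> [{}x {}y [xA yA [z zS zE]]|{}x|{}x {}y z _ yx _ zy].
- by apply: rt_step; split=> //; exists z; rewrite // (addrC y).
- exact: rt_refl.
- exact: rt_trans zy yx.
Qed.

Lemma linked_step x y z : atoms S x -> atoms S y -> S z -> x + y + z = s ->
  linked x y.
Proof. by move=> xA yA zS zE; apply: rt_step; split=> //; exists z. Qed.

Context (s2 : sumset (star S) (star S) s)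
  (sNA : ~ sumset (atoms S) (atoms S) s).

(** Otherwise each of [u], [v] is zero, an atom or a gap. If one is zero, the other is [s], which is
    in [2 S^*]. Two atoms contradict [sNA]. If a gap occurs beside an atom or a gap, the inclusions
    put [s] in [H], [A] or [2A], all excluded. *)
Lemma complement_star2 u v : u + v = s ->
  ~ sumset (star S) (star S) u -> sumset (star S) (star S) v.
Proof.
move=> uvE uN2; apply: contrapT => vN2.
have sS : S s by case: s2 => x [xS _] [y [yS _] <-]; exact: submonoidD.
have sNatom : ~ atoms S s by case.
have [uS|uG] := pselect (S u); have [vS|vG] := pselect (S v).
- have [u0|uN0] := pselect (u = 0).
    by apply: vN2; move: uvE; rewrite u0 add0r => ->.
  have [v0|vN0] := pselect (v = 0).
    by apply: uN2; move: uvE; rewrite v0 addr0 => ->.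
  by apply: sNA; exists u => //; exists v.
- have uN0 : u <> 0 by move=> u0; apply: vG; rewrite -[v]add0r -u0 uvE.
  have [|//|//] := hgap.2 s.
  by exists v => //; exists u => //; rewrite addrC.
- have vN0 : v <> 0 by move=> v0; apply: uG; rewrite -[u]addr0 -v0 uvE.
  by have [|//|//] := hgap.2 s; exists u => //; exists v.
- by have [|[]|] := hgap.1 s; first by exists u => //; exists v.
Qed.

Lemma complement_atom_star2 a : (a.1 <= s.1)%N -> (a.2 <= s.2)%N -> atoms S a ->
  sumset (star S) (star S) (s.1 - a.1, s.2 - a.2)%N.
Proof.
move=> le1 le2 [_ aN2]; apply: complement_star2 aN2.
by apply/addN2_eq; split=> /=; lia.
Qed.

(** Write [s - u = y + z] in [2 S^*]. An atom [a] split off [y] is adjacent to [u], and also to [x],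
    because [s - x - a] lies above [z]. *)
Lemma linked_le x u : atoms S x -> atoms S u ->
  (x.1 <= u.1 <= s.1)%N -> (x.2 <= u.2 <= s.2)%N -> linked x u.
Proof.
move=> xA uA /andP[xu1 us1] /andP[xu2 us2].
have [y yS [z zS /addN2_eq[/= E1 E2]]] := complement_atom_star2 u us1 us2 uA.
have [a aA [c cS /addN2_eq[F1 F2]]] := star_atomD y yS.
have [z0 _] := zS.
apply: (rt_trans _ _ _ a).
  apply: (linked_step _ _ (s.1 - x.1 - a.1, s.2 - x.2 - a.2)%N) => //.
    by have [] : star S (s.1 - x.1 - a.1, s.2 - x.2 - a.2)%N
      by apply: star_up zS => /=; lia.
  by apply/addN2_eq; split=> /=; lia.
apply: linked_sym; apply: (linked_step _ _ (c + z)) => //.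
  exact: submonoidD.
by apply/addN2_eq; split=> /=; lia.
Qed.

(* Move [a] towards [b] through linked atoms as long as possible. When stuck, the
   generators of [S^*] next to the corner [(a.1, b.2)] are [(0, a.2)] below [a] and
   [(a.1 + 1, 0)] below [b], and these two atoms are adjacent. *)
Lemma linked_antichain a b : atoms S a -> atoms S b ->
  (a.1 < b.1 <= s.1)%N -> (b.2 < a.2 <= s.2)%N -> linked a b.
Proof.
have [n] := ubnP (b.1 - a.1 + (a.2 - b.2))%N.
elim: n a => // n IHn a ltn aA bA /andP[ab1 bs1] /andP[ba2 as2].
(* Any move inside the rectangle spanned by [a] and [b] shrinks the induction measure; on the sides
   through [b] the new atom is comparable with [b]. *)
have closer c : atoms S c -> linked a c ->
    (a.1 <= c.1 <= b.1)%N -> (b.2 <= c.2 <= a.2)%N ->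
    ((c.1 != a.1) || (c.2 != a.2))%N -> linked a b.
  move=> cA ac /andP[ac1 cb1] /andP[bc2 ca2] ne; apply: rt_trans ac _.
  have [c1E|c1N] := eqVneq c.1 b.1.
    by apply: linked_sym; apply: linked_le => //; lia.
  have [c2E|c2N] := eqVneq c.2 b.2.
    by apply: linked_le => //; lia.
  by apply: IHn => //; lia.
have [gS|gN] := pselect (star S (a.1, b.2)).
  have gA : atoms S (a.1, b.2) by apply: atom_down aA gS => /=; lia.
  apply: (closer (a.1, b.2)) => //=; try lia.
  by apply: linked_sym; apply: linked_le => //=; lia.
have [dS|dN] := pselect (star S (a.1, a.2.-1)).
  have dA : atoms S (a.1, a.2.-1) by apply: atom_down aA dS => /=; lia.
  apply: (closer (a.1, a.2.-1)) => //=; try lia.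
  by apply: linked_sym; apply: linked_le => //=; lia.
have aS : star S a by case: aA.
(* The right neighbour of [a] is an atom, hence a move, or a sum [x + y]; then [dN] and [gN] force
   [x = (0, a.2)] and [y = (a.1 + 1, 0)]. *)
have [rA|[x xS [y yS]]] := atom_or_sum (a.1.+1, a.2)
    (star_up a (a.1.+1, a.2) (leqnSn _) (leqnn _) aS).
  apply: (closer (a.1.+1, a.2)) => //=; try lia.
  by apply: linked_le => //=; lia.
wlog x2 : x y xS yS / (0 < x.2)%N.
  move=> wl /addN2_eq/= xyE.
  have [x2|x2] := posnP x.2.
    by apply: (wl y x) => //; [|apply/addN2_eq => /=]; lia.
  by apply: (wl x y) => //; apply/addN2_eq.
move=> /addN2_eq/= [E1 E2].
have y1 : (0 < y.1)%N.
  rewrite lt0n; apply/eqP => y1; apply: dN.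
  by apply: star_up yS => /=; lia.
have x2E : x.2 = a.2.
  apply/eqP; apply: contrapT => x2N; apply: dN.
  by apply: star_up xS => /=; lia.
have y1E : y.1 = a.1.+1.
  apply/eqP; apply: contrapT => y1N; apply: gN.
  by apply: star_up yS => /=; lia.
have xA : atoms S x by apply: atom_down aA xS; lia.
have yA : atoms S y by apply: atom_down bA yS; lia.
apply: (rt_trans _ _ _ x); first by apply: linked_sym; apply: linked_le => //; lia.
apply: (rt_trans _ _ _ y); last by apply: linked_le => //; lia.
(* Adjacency of [x] and [y] needs [s - a - (1, 0)] in [S]. Since [a.1 < s.1], one of [u], [v] has a
   positive first coordinate and can give up the unit, so the other lies below this element. *)
have [u uS [v vS /addN2_eq[/= F1 F2]]] :
  sumset (star S) (star S) (s.1 - a.1, s.2 - a.2)%N.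
  by apply: complement_atom_star2 => //; lia.
have [zS _] : star S (s.1 - a.1.+1, s.2 - a.2)%N.
  have [u0|u0] := posnP u.1.
    by apply: star_up uS => /=; lia.
  by apply: star_up vS => /=; lia.
apply: linked_step zS _ => //.
by apply/addN2_eq; split=> /=; lia.
Qed.

Lemma linked_atoms a b : atoms S a -> atoms S b ->
  (a.1 <= s.1)%N -> (a.2 <= s.2)%N -> (b.1 <= s.1)%N -> (b.2 <= s.2)%N ->
  linked a b.
Proof.
move=> aA bA as1 as2 bs1 bs2.
wlog ab1 : a b aA bA as1 as2 bs1 bs2 / (a.1 <= b.1)%N.
  move=> wl; have [|/ltnW] := leqP a.1 b.1; first exact: wl.
  by move=> ba1; apply: linked_sym; apply: wl.
have [ab2|ba2] := leqP a.2 b.2; first by apply: linked_le => //; lia.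
have [ab1E|ab1N] := eqVneq a.1 b.1.
  by apply: linked_sym; apply: linked_le => //; lia.
by apply: linked_antichain => //; lia.
Qed.

End Linked.

Lemma connected_of_linked s :
  (forall a b, betti_vertices S s a -> betti_vertices S s b -> linked s a b) ->
  graph_connected (@betti_edge S s).
Proof.
move=> all_linked a b.
have := all_linked _ _ (set_valP a) (set_valP b).
move: {-2}(val a) (erefl (val a)) {-2}(val b) (erefl (val b)) => x xE y yE.
move=> /clos_rt_rt1n_iff xy; elim: xy a b xE yE => {x y} [x|x y z xy yz IH] a b.
  by move=> -> /val_inj ->; exact: rt_refl.
move=> xE zE; case: xy => xA yA [w wS wE].
have yV : betti_vertices S s y.
  split=> //; exists (x + w); last by rewrite addrCA addrA.
  by apply: submonoidD => //; case: xA => -[].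
pose c : betti_vertices S s := SigSub (mem_set yV).
have cE : y = val c by [].
apply: (rt_trans _ _ _ c); last exact: IH.
(* [linked] admits a step from an atom to itself, which is not an edge of the graph. *)
have [->|ac] := pselect (a = c); first exact: rt_refl.
apply: rt_step; split=> //; exists w => //.
by rewrite -xE -cE.
Qed.

(** * Factorizations as sequences of atoms *)

Definition multiplicities (t : seq (atoms S)) : {fsfun atoms S -> nat with 0%N} :=
  [fsfun a in [fset x in t]%fset => count_mem a t | 0%N].

Lemma multiplicitiesE t a : multiplicities t a = count_mem a t.
Proof.
by rewrite fsfunE inE; case: ifPn => // /count_memPn ->.
Qed.

Lemma factorizations_multiplicities t s : \sum_(a <- t) val a = s ->
  factorizations S s (multiplicities t).
Proof.
move=> <-; rewrite /factorizations /=.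
rewrite -[RHS]big_undup_iterop_count /=.
under [RHS]eq_bigr do rewrite Monoid.iteropE iter_addr_0.
under eq_bigr do rewrite multiplicitiesE.
apply/perm_big/uniq_perm; rewrite ?undup_uniq ?fset_uniq // => a.
by rewrite mem_undup mem_finsupp multiplicitiesE -lt0n -has_count has_pred1.
Qed.

(** Repeating each atom [l a] times recovers [l], so factorizations can be handled as sequences. *)
Lemma multiplicitiesP s l : factorizations S s l ->
  exists2 t, l = multiplicities t & \sum_(a <- t) val a = s.
Proof.
pose t := flatten [seq nseq (l a) a | a <- finsupp l].
move=> lE; exists t.
  apply/fsfunP => a; rewrite multiplicitiesE count_flatten -map_comp sumnE big_map.
  under eq_bigr do rewrite /= count_nseq /=.
  have [la|la0] := boolP (a \in finsupp l).
    rewrite (bigD1_seq a) ?fset_uniq //= eqxx mul1n big1 ?addn0 // => x xa.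
    by rewrite (negPf xa).
  rewrite (fsfun_dflt la0) big_seq big1 // => x xl; case: eqVneq => //= xa.
  by rewrite -xa xl in la0.
rewrite big_flatten big_map -lE.
by apply: eq_bigr => a _; rewrite big_nseq iter_addr_0.
Qed.

Lemma sum_atoms_mem (t : seq (atoms S)) : S (\sum_(a <- t) val a).
Proof.
elim: t => [|a t IHt]; first by rewrite big_nil; exact: submonoid0.
by rewrite big_cons; apply: submonoidD => //; exact: atom_mem (set_valP a).
Qed.

Lemma sum_atoms_exists x : S x -> exists t : seq (atoms S), \sum_(a <- t) val a = x.
Proof.
have [n] := ubnP (x.1 + x.2)%N; elim: n x => // n IHn x ltn xS.
have [->|xN0] := pselect (x = 0); first by exists [::]; rewrite big_nil.
have [//|a aA [c cS acE]] := star_atomD x.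
have [|t tE] := IHn c _ cS.
  have /starP[_ a0] : star S a by case: aA.
  by move/addN2_eq: acE => [? ?]; lia.
by exists ((SigSub (mem_set aA) : atoms S) :: t); rewrite big_cons tE.
Qed.

Lemma sum_atoms_atom t (p : atoms S) : \sum_(a <- t) val a = val p -> t = [:: p].
Proof.
have aS (a : atoms S) : star S (val a) by have [] := set_valP a.
have [[_ p0] pN2] := set_valP p.
case: t => [|x [|y t]]; rewrite ?big_nil ?big_cons.
- by move=> pE; case: p0.
- by rewrite big_nil addr0 => /val_inj ->.
move=> pE; case: pN2; exists (val x) => //; exists (val y + \sum_(a <- t) val a) => //.
by apply: starD => //; exact: sum_atoms_mem.
Qed.

(** Cancelling the shared atom leaves a factorization of the other atom, which must be trivial. *)
Lemma factorization_two s (a b : atoms S) :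
  val a + val b = s -> forall c t, \sum_(x <- c :: t) val x = s ->
  (c = a \/ c = b) -> perm_eq (c :: t) [:: a; b].
Proof.
move=> <- c t; rewrite big_cons => tE [ca|cb].
  by move: tE; rewrite ca => /addN2_cancel/sum_atoms_atom ->.
move: tE; rewrite cb [RHS]addrC => /addN2_cancel/sum_atoms_atom ->.
by rewrite (perm_catC [:: b] [:: a]).
Qed.

(** * Betti elements and their factorizations *)

Lemma gap_absorbing_Betti_atoms2 s : Betti S s -> sumset (atoms S) (atoms S) s.
Proof.
move=> [sS sNC]; apply: contrapT => sNA; apply: sNC.
(* Three connected cases: [0] has no vertices, an atom has only itself, and an element of [2 S^*]
   outside [2A] is handled by links. *)
have [s0|sN0] := pselect (s = 0).
  apply: connected_of_linked => a b [[/starP[_ a0] _] [c _ /addN2_eq[]]].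
  by rewrite s0 /=; lia.
have [sA|s2] := atom_or_sum s (conj sS sN0).
  apply: connected_of_linked => a b.
  have eq_s c : betti_vertices S s c -> c = s.
    move=> [[cS _] [d dS cdE]]; have [d0|dN0] := pselect (d = 0).
      by rewrite -cdE d0 addr0.
    by case: sA => _ []; exists c => //; exists d.
  by move=> /eq_s -> /eq_s ->; exact: rt_refl.
apply: connected_of_linked => a b [aA [c _ /addN2_eq[? ?]]] [bA [d _ /addN2_eq[? ?]]].
by apply: linked_atoms => //; lia.
Qed.

(** Extend two unconnected vertices to factorizations. If these coincided, both vertices would occur
    in a single one and so be joined by an edge. *)
Lemma Betti_two_factorizations s : Betti S s ->
  exists l m, [/\ factorizations S s l, factorizations S s m & l <> m].
Proof.
move=> [sS sNC].
have [a [b ab]] : exists a b, ~ clos_refl_trans _ (@betti_edge S s) a b.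
  apply: contrapT => nab; apply: sNC => a b; apply: contrapT => ab.
  by apply: nab; exists a, b.
have abN : a <> b by move=> abE; apply: ab; rewrite abE; exact: rt_refl.
have extend (c : betti_vertices S s) : exists2 t : seq (atoms S),
    \sum_(x <- t) val x = s & exists2 c' : atoms S, val c' = val c & c' \in t.
  have [cA [d dS cdE]] := set_valP c.
  have [t tE] := sum_atoms_exists d dS.
  exists ((SigSub (mem_set cA) : atoms S) :: t); first by rewrite big_cons tE.
  by exists (SigSub (mem_set cA)); rewrite ?mem_head.
have [t tE [a' a'E a't]] := extend a; have [u uE [b' b'E b'u]] := extend b.
exists (multiplicities t), (multiplicities u); split;
  try exact: factorizations_multiplicities.
move=> tu; apply: ab; apply: rt_step; split=> //.
have b't : b' \in t.
  by move: b'u; rewrite -!has_pred1 !has_count -!multiplicitiesE tu.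
have b'a' : b' != a'.
  by apply/eqP => ba; apply: abN; apply: val_inj; rewrite -a'E -b'E ba.
have b'r : b' \in rem a' t.
  by move: b't; rewrite (perm_mem (perm_to_rem a't)) inE (negPf b'a').
exists (\sum_(x <- rem b' (rem a' t)) val x); first exact: sum_atoms_mem.
rewrite -a'E -b'E -addrA -tE (perm_big _ (perm_to_rem a't)) big_cons.
by rewrite (perm_big _ (perm_to_rem b'r)) big_cons.
Qed.

(** A neighbour [c] of [p] divides the atom [q] in [S], so [c = q], and symmetrically. Were the
    graph connected, every factorization would start with [p] or [q], hence be [p + q]. *)
Lemma atoms2_Betti s l m : sumset (atoms S) (atoms S) s ->
  factorizations S s l -> factorizations S s m -> l <> m -> Betti S s.
Proof.
move=> s2A; have sS := atoms2_mem s s2A.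
have [p pA [q qA pqE]] := s2A.
move=> /multiplicitiesP[t -> tE] /multiplicitiesP[u -> uE] tu.
split=> // sC; apply: tu; apply/fsfunP => x; rewrite !multiplicitiesE.
pose P : atoms S := SigSub (mem_set pA); pose Q : atoms S := SigSub (mem_set qA).
have pV : betti_vertices S s p by split=> //; exists q => //; exact: atom_mem.
have cofactor a b c : a + b = s -> atoms S b -> atoms S c ->
    le_monoid S (a + c) s -> c = b.
  move=> <- [_ bN2] cA [z zS]; rewrite -addrA => /addN2_cancel czE.
  have [z0|zN0] := pselect (z = 0); first by rewrite -czE z0 addr0.
  by case: bN2; exists c; [case: cA|exists z].
have vertex_pq (a : betti_vertices S s) : val a = p \/ val a = q.
  have /clos_rt_rtn1_iff := sC (SigSub (mem_set pV)) a.
  elim=> [|b c [_ bc] _ IHb]; first by left.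
  have [cA _] := set_valP c.
  case: IHb bc => ->; first by move=> /(cofactor _ _ _ pqE qA cA); right.
  rewrite addrC in pqE.
  by move=> /(cofactor _ _ _ pqE pA cA); left.
have pair_of (r : seq (atoms S)) : \sum_(a <- r) val a = s -> perm_eq r [:: P; Q].
  case: r => [|c r] rE.
    case: (starD p q pA.1 (atom_mem q qA)) => _ [].
    by rewrite pqE -rE big_nil.
  apply: (factorization_two s) => //.
  have cV : betti_vertices S s (val c).
    split; first exact: set_valP.
    exists (\sum_(a <- r) val a); first exact: sum_atoms_mem.
    by rewrite -rE big_cons.
  by have [cE|cE] := vertex_pq (SigSub (mem_set cV));
    [left|right]; apply: val_inj.
by have /permP -> := pair_of t tE; have /permP -> := pair_of u uE.
Qed.
End GapAbsorbing.

Theorem proposition8p6 (S : set N2) (hS : submonoid S)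
    (hgap : gap_absorbing S) (s : N2) :
  Betti S s <->
  sumset (atoms S) (atoms S) s /\ `I_2 #<= factorizations S s.
Proof.
rewrite card_ge2P; split=> [sB|[sA [l [m [lZ mZ lm]]]]].
  by split; [exact: gap_absorbing_Betti_atoms2|exact: Betti_two_factorizations].
exact: (atoms2_Betti hS _ _ _ sA lZ mZ lm).
Qed.
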